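(* Let $n$ be a positive integer. All downsets $\mathcal{F}$ with $|U(\mathcal{F})|\le n$ have the star property if and only if the integer program $I_n$ is infeasible.
   Context: Let $[n]=\{1,\dots,n\}$ and $2^{[n]}$ its power set. A family is a set of subsets of a finite ground set; $U(\mathcal{F})$ is the union of all sets in $\mathcal{F}$. A family $\mathcal{D}$ is a downset if $A\in\mathcal{D}$, $B\subseteq A$ imply $B\in\mathcal{D}$. A family is intersecting if any two of its sets have nonempty intersection; it is a star if some element of $U(\mathcal{F})$ lies in all its sets; $\mathcal{F}$ has the star property if some maximum-cardinality intersecting family contained in $\mathcal{F}$ is a star. The integer program $I_n$ has binary variables $x_S, y_S\in\{0,1\}$ for all $S\in 2^{[n]}$, objective $\max \sum_{S\in 2^{[n]}} x_S$, and constraints: (i) $x_T\le x_S$ for all $S,T\in 2^{[n]}$ with $S\subsetneq T$; (ii) $y_T+y_S\le 1$ for all nonempty $S,T\in 2^{[n]}$ with $S\cap T=\emptyset$; (iii) $y_S\le x_S$ for all $S\in 2^{[n]}$; (iv) $\sum_{S\in 2^{[n]}: i\in S} x_S + 1 \le \sum_{S\in 2^{[n]}\setminus\{\emptyset\}} y_S$ for all $i\in[n]$.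
   Formalization: The empty family is counted as a star, so that the downsets ∅ and {∅} have the star property; under the literal definition {∅} has no star as a maximum intersecting family and the equivalence would fail, e.g. for n = 1. *)

(* Defs.v *)
From mathcomp Require Import all_boot.

Set Implicit Arguments.
Unset Strict Implicit.
Unset Printing Implicit Defensive.

(* A family over a finite ground set T is an element of {set {set T}};
   the union U(F) of its members is [cover F]. *)

Definition downset (T : finType) (D : {set {set T}}) : Prop :=
  forall A B : {set T}, A \in D -> B \subset A -> B \in D.

(* The two sets need not be distinct, so an intersecting family does not
   contain set0. *)
Definition intersecting (T : finType) (G : {set {set T}}) : Prop :=
  forall A B : {set T}, A \in G -> B \in G -> A :&: B != set0.

(* The empty family counts as a star. This convention is only relevant for the
   downsets set0 and [set set0], whose only intersecting subfamily is empty;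
   see [max_intersecting_neq0]. *)
Definition star (T : finType) (G : {set {set T}}) : Prop :=
  G = set0 \/
  exists2 a : T, a \in cover G & forall A : {set T}, A \in G -> a \in A.

Definition max_intersecting_in (T : finType) (F G : {set {set T}}) : Prop :=
  [/\ G \subset F, intersecting G &
      forall H : {set {set T}},
        H \subset F -> intersecting H -> #|H| <= #|G|].

Definition star_property (T : finType) (F : {set {set T}}) : Prop :=
  exists2 G : {set {set T}}, max_intersecting_in F G & star G.

Lemma max_intersecting_neq0 (T : finType) (F G : {set {set T}}) :
  cover F != set0 -> max_intersecting_in F G -> G != set0.
Proof.
case/set0Pn=> a /bigcupP[A AF aA] [_ _ /(_ [set A])].
rewrite sub1set AF cards1 card_gt0; apply=> // B C.
by rewrite !inE => /eqP-> /eqP->; rewrite setIid; apply/set0Pn; exists a.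
Qed.

Record max_program := MaxProgram {
  point : Type;
  objective : point -> nat;
  feasible : point -> Prop
}.

Definition infeasible (P : max_program) : Prop :=
  ~ exists p : point P, feasible p.

(* The binary variables x_S and y_S, with [n] rendered as 'I_n. *)
Record assignment (n : nat) := Assignment {
  x_ : {set 'I_n} -> bool;
  y_ : {set 'I_n} -> bool
}.

(* Booleans are coerced to the naturals 0 and 1. *)
Record I_constraints (n : nat) (v : assignment n) : Prop := IConstraints {
  I_downset : forall S T : {set 'I_n}, S \proper T -> (x_ v T <= x_ v S)%N;
  I_intersecting : forall S T : {set 'I_n},
    S != set0 -> T != set0 -> S :&: T = set0 -> (y_ v T + y_ v S <= 1)%N;
  I_contained : forall S : {set 'I_n}, (y_ v S <= x_ v S)%N;
  I_nonstar : forall i : 'I_n,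
    (\sum_(S : {set 'I_n} | i \in S) x_ v S + 1
       <= \sum_(S : {set 'I_n} | S != set0) y_ v S)%N
}.

Definition I_program (n : nat) : max_program :=
  {| point := assignment n;
     objective := fun v => \sum_(S : {set 'I_n}) x_ v S;
     feasible := @I_constraints n |}.

(* Main.v *)
(** A feasible point of [I_n] is a downset [x] together with an intersecting
    subfamily [y] strictly larger than each of the subfamilies of [x] formed by
    the members through a fixed point.  In a downset without the star property,
    a maximum intersecting subfamily is such a [y]; relabelling the at most [n]
    points of the cover by elements of ['I_n] turns it into a feasible point. *)

Require Import Defs.
From mathcomp Require Import all_boot.

Lemma sum_nat_mem (T : finType) (P : pred T) (A : {set T}) :
  \sum_(x | P x) (x \in A : nat) = #|[set x in A | P x]|.
Proof.
rewrite -sum1_card -big_mkcondr; apply: eq_bigl => x.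
by rewrite inE andbC.
Qed.

Lemma exists_max_intersecting {T : finType} (F : {set {set T}}) :
  exists G, max_intersecting_in F G.
Proof.
(* A boolean form of the property, so that [arg_maxnP] can choose a largest family; the empty family
   is the starting witness. *)
pose P (G : {set {set T}}) := (G \subset F) &&
  [forall A in G, forall B in G, A :&: B != set0].
have PP (G : {set {set T}}) : reflect (G \subset F /\ intersecting G) (P G).
  apply: (iffP andP) => -[GF GI]; split=> //.
    by move=> A B AG; apply: (forall_inP (forall_inP GI A AG)).
  by apply/forall_inP=> A AG; apply/forall_inP=> B; apply: GI.
have P0 : P set0 by apply/PP; split=> [|A B]; rewrite ?sub0set ?inE.
case: (arg_maxnP (fun G : {set {set T}} => #|G|) P0) => G /PP[GF GI] Gmax.
by exists G; split=> // H HF HI; apply/Gmax/PP.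
Qed.

Lemma intersecting_star (T : finType) (F : {set {set T}}) (a : T) :
  intersecting [set A in F | a \in A].
Proof.
move=> A B; rewrite !inE => /andP[_ aA] /andP[_ aB].
by apply/set0Pn; exists a; rewrite inE aA.
Qed.

(** All members of [F] through [a] form an intersecting family; being at least as large as the
    maximum [G], it is itself maximum. *)
Lemma star_property_of_large_star {T : finType} {F G : {set {set T}}} {a : T} :
  max_intersecting_in F G -> #|G| <= #|[set A in F | a \in A]| ->
  star_property F.
Proof.
move=> [GF GI Gmax] Ga; exists [set A in F | a \in A].
  split=> [||H HF HI].
  - by apply/subsetP=> A; rewrite inE => /andP[].
  - exact: intersecting_star.
  - exact: leq_trans (Gmax H HF HI) Ga.
have [->|[A AFa]] := set_0Vmem [set A in F | a \in A]; first by left.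
right; exists a => [|B]; last by rewrite inE => /andP[].
by apply/bigcupP; exists A => //; move: AFa; rewrite inE => /andP[].
Qed.

Lemma exists_inj_ord {T : finType} {C : {set T}} {n : nat} :
  0 < n -> #|C| <= n -> exists f : T -> 'I_n, {in C &, injective f}.
Proof.
(* Points of [C] are numbered by their position in [enum C]; the values outside [C] are
   irrelevant. *)
case: n => // n _ Cn; exists (fun t => inord (index t (enum C))) => a b aC bC.
have idx c : c \in C -> index c (enum C) < n.+1.
  by move=> cC; rewrite (leq_trans _ Cn) // cardE index_mem mem_enum.
move=> /(congr1 val) /=; rewrite !inordK ?idx //.
by apply: (index_inj a); rewrite mem_enum.
Qed.

Lemma imset_inj_in {aT rT : finType} {f : aT -> rT} {C : {set aT}} :
  {in C &, injective f} ->
  {in powerset C &, injective (fun A : {set aT} => f @: A)}.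
Proof.
move=> f_inj.
have sub (A B : {set aT}) :
    A \subset C -> B \subset C -> f @: A = f @: B -> A \subset B.
  move=> AC BC eqAB; apply/subsetP=> a aA.
  have /imsetP[b bB /f_inj->] // : f a \in f @: B by rewrite -eqAB imset_f.
  - exact: (subsetP AC).
  - exact: (subsetP BC).
move=> A B; rewrite !powersetE => AC BC eqAB.
by apply/eqP; rewrite eqEsubset (sub A B) // (sub B A).
Qed.

Lemma star_property_not_feasible {n : nat} {v : assignment n} :
  0 < n -> I_constraints v -> ~ star_property [set S | x_ v S].
Proof.
case: v => x y n_gt0 [/= _ Iint Icont Istar] [G [GX _ Gmax] Gstar].
have sumX i : \sum_(S : {set 'I_n} | i \in S) x S =
    #|[set S in [set S | x S] | i \in S]|.
  by rewrite -sum_nat_mem; apply: eq_bigr => S _; rewrite inE.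
have sumY : \sum_(S : {set 'I_n} | S != set0) y S =
    #|[set S in [set S | y S] | S != set0]|.
  by rewrite -sum_nat_mem; apply: eq_bigr => S _; rewrite inE.
(* The nonempty sets selected by [y] form an intersecting subfamily of [x], hence number at most
   [#|G|]; so the strict bound on stars passes from [y] to [G]. *)
have {}Istar i : #|[set S in [set S | x S] | i \in S]| < #|G|.
  rewrite -addn1 -sumX (leq_trans (Istar i)) // sumY; apply: Gmax.
    apply/subsetP=> S; rewrite !inE => /andP[yS _].
    by move: (Icont S); rewrite yS lt0b.
  move=> A B; rewrite !inE => /andP[yA A0] /andP[yB B0].
  by apply/eqP=> /(Iint _ _ A0 B0); rewrite yA yB.
(* An empty [G] contradicts the strict bound at any index, and one exists as [n] is positive;
   otherwise [G] lies inside the star at its centre [a], which is strictly smaller. *)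
case: Gstar => [G0|[a _ aG]].
  by move: (Istar (Ordinal n_gt0)); rewrite G0 cards0.
have := Istar a; rewrite ltnNge => /negP; apply.
apply/subset_leq_card/subsetP=> S SG.
by rewrite inE (subsetP GX) ?aG.
Qed.

(** Take images under a map [f] to ['I_n] injective on the cover: [G] keeps its size and no star
    grows. *)
Lemma feasible_of_small_stars {n : nat} {T : finType} {F G : {set {set T}}} :
  0 < n -> downset F -> #|cover F| <= n -> G \subset F -> intersecting G ->
  G != set0 -> (forall a, #|[set A in F | a \in A]| < #|G|) ->
  exists v : assignment n, I_constraints v.
Proof.
move=> n_gt0 Fdown Fn GF GI G0 Gstar.
have [f f_inj] := exists_inj_ord n_gt0 Fn.
have FC A : A \in F -> A \subset cover F by move=> AF; apply: bigcup_sup.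
have GC A : A \in G -> A \in powerset (cover F).
  by move=> AG; rewrite powersetE FC // (subsetP GF).
pose img (H : {set {set T}}) := [set f @: (A : {set T}) | A in H].
exists (Assignment (fun S => S \in img F) (fun S => S \in img G)); split=> /=.
- move=> S U /proper_sub SU; case: imsetP => // -[A AF defU]; rewrite lt0b.
  (* A subset of [f @: A] is the image of a subset of [A], which lies in the downset [F]. *)
  have -> : S = f @: (A :&: f @^-1: S).
    apply/setP=> i; apply/idP/imsetP=> [iS|[a]]; last first.
      by rewrite !inE => /andP[_ aS] ->.
    have /imsetP[a aA defi] : i \in f @: A by rewrite -defU (subsetP SU).
    by exists a => //; rewrite !inE aA -defi.
  by apply: imset_f; apply: Fdown AF _; apply: subsetIl.
- move=> S U _ _ SU; case: imsetP => [[A AG defU]|_]; last by case: (_ \in _).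
  case: imsetP => [[B BG defS]|] //.
  have /set0Pn[a /setIP[aA aB]] := GI _ _ AG BG.
  have : f a \in S :&: U by rewrite inE defU defS !imset_f.
  by rewrite SU inE.
- move=> S; case: imsetP => // -[A AG ->].
  by rewrite lt0b imset_f // (subsetP GF).
move=> i; rewrite !sum_nat_mem addn1.
have -> : [set S in img G | S != set0] = img G.
  apply/setP=> S; rewrite inE andb_idr // => /imsetP[A AG ->].
  by rewrite imset_eq0; have := GI _ _ AG AG; rewrite setIid.
rewrite (card_in_imset (sub_in2 GC (imset_inj_in f_inj))).
(* If no member of [img F] contains [i], it suffices that [G] is nonempty. Otherwise [i] is [f a]
   for some [a] in the cover, and by injectivity every member through [i] is the image of a member
   of [F] through [a]. *)
have [->|[S]] := set_0Vmem [set S in img F | i \in S].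
  by rewrite cards0 card_gt0.
rewrite inE => /andP[/imsetP[A AF ->] /imsetP[a aA ->]].
apply: leq_ltn_trans (Gstar a).
apply: leq_trans (leq_imset_card (fun A : {set T} => f @: A) _).
apply/subset_leq_card/subsetP=> U.
rewrite inE => /andP[/imsetP[B BF ->] /imsetP[b bB fab]].
apply: imset_f; rewrite inE BF.
by rewrite (f_inj a b (subsetP (FC A AF) a aA) (subsetP (FC B BF) b bB)).
Qed.

Theorem theorem2p1 (n : nat) (hn : 0 < n) :
  (forall (T : finType) (F : {set {set T}}),
      downset F -> #|cover F| <= n -> star_property F)
  <-> infeasible (I_program n).
Proof.
split=> [starF [v v_feas]|infeas T F Fdown Fn].
  apply: (star_property_not_feasible hn v_feas); apply: starF.
    (* Constraint (i) only speaks of strict inclusions, so equality is split off. *)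
    move=> A B; rewrite !inE => xA; rewrite subEproper => /predU1P[-> //|BA].
    by have := I_downset v_feas BA; rewrite xA lt0b.
  by rewrite -[n in _ <= n]card_ord max_card.
have [G Gmax] := exists_max_intersecting F.
have [G0|G0] := eqVneq G set0; first by exists G => //; left.
case: (boolP [exists a, #|G| <= #|[set A in F | a \in A]|]) => [/existsP[a]|].
  exact: star_property_of_large_star Gmax.
move/existsPn=> Gstar; case: Gmax => GF GI _; case: infeas.
apply: (feasible_of_small_stars hn Fdown Fn GF GI G0) => a.
by rewrite ltnNge.
Qed.
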